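(* Let $n\ge2$, $1<q<2$, let $u$ be a nodal solution of $$u''+\frac{n-1}{r}u'+u-|u|^{q-2}u=0,\qquad u(0)=\alpha>0,\quad u'(0)=0,$$ with exactly $k$ zeros before $z_u$ if $u$ is a bound state, and exactly $k+1$ zeros before $z_u=+\infty$ if $u$ is not a bound state ($k\ge1$). Suppose that $Q(c_{i-1})>0$ and $M(c_{i-1})>0$ for some $i\in\{2,\dots,k,k+1\}$, and let $\tau_i\in(c_{i-1},r_i)$ be the first zero of $v$ in $(c_{i-1},r_i)$ (which exists under these hypotheses). If $\tau_i>b_i$, then for every $\widetilde u\ge|u(b_i)|=\alpha_*$ one has $$B_a(\tau_i)-B_a(b_i)=\int_{b_i}^{\tau_i}-2F_a(u(r))\,\frac{Q_n(r)}{r\,u'(r)^2}\,dr>0,$$ where $a=g_2(\widetilde u)\ge0$.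
   Context: Let $f(u)=u-|u|^{q-2}u$, $F(u)=\frac12u^2-\frac1q|u|^q$, and $\alpha_*=(2/q)^{1/(2-q)}$, the positive zero of $F$. $z_u\in(0,+\infty]$ is the first double zero of $u$, i.e. the first $r$ with $u=u'=0$ ($+\infty$ if none); zeros ''before $z_u$'' are zeros in $(0,z_u)$, and they are all simple. A nodal solution is one that changes sign in $(0,z_u)$; a bound state is a solution that changes sign with $u(r)\to0$ as $r\to\infty$ (then $z_u<\infty$). $v=\partial_\alpha u$ is the derivative of $u(r,\alpha)$ with respect to the initial value; it is $C^1$ on $[0,z_u)$ and satisfies $v''+\frac{n-1}rv'+f'(u)v=0$ off the zeros of $u$, $v(0)=1$, $v'(0)=0$. Labels. Let $z_1<z_2<\cdots$ be the zeros of $u$ in $(0,z_u)$; if $u$ is a bound state with $k$ zeros put $z_{k+1}:=z_u$. The critical points of $u$ in $[0,z_{k+1})$ are exactly $0=c_0<c_1<\cdots<c_k$ with $c_i\in(z_i,z_{i+1})$ for $1\le i\le k$, and $|u(c_i)|>\alpha_*$. For $1\le i\le k+1$, $b_i<r_i$ are the unique points of $(c_{i-1},z_i)$ with $|u(b_i)|=\alpha_*$ and $|u(r_i)|=1$. Auxiliary functions: $$Q(r)=r^n[u'v'+f(u)v]+(n-2)r^{n-1}u'v,\qquad Q_n(r)=Q(r)+n\,r^{n-1}u'v,\qquad M(r)=r^{n-1}(u'v-uv'),$$ $$g_2(u)=\frac{2F(u)}{uf(u)-2F(u)}\ (u\neq0),\qquad F_a(u)=F(u)-\frac a2\bigl[uf(u)-2F(u)\bigr],$$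 and, where $u'\ne0$, $$B_a(r)=Q(r)-aM(r)-2F_a(u(r))\,\frac{r^{n-1}v(r)}{u'(r)}.$$ *)

(* Defs.v *)
From Stdlib Require Import Reals.
From Coquelicot Require Import Coquelicot.
Open Scope R_scope.

(** [|x|^p] with the convention [|0|^p = 0].  The case split is needed because
    [Rpower 0 p = 1] in the standard library.  For [p = q - 2 < 0] the value at
    [0] only occurs multiplied by [x = 0]. *)
Definition abs_pow (x p : R) : R :=
  if Req_EM_T x 0 then 0 else Rpower (Rabs x) p.

Definition f (q x : R) : R := x - abs_pow x (q - 2) * x.

Definition F (q x : R) : R := / 2 * x ^ 2 - / q * abs_pow x q.

Definition alpha_star (q : R) : R := Rpower (2 / q) (1 / (2 - q)).

(** [w] is of class [C^1] on [[0, z)], with [w(0) = w0] and [w'(0) = 0].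
    [Derive] is two-sided and functions on [[0, z)] are represented by functions
    on [R] whose values on negative numbers are irrelevant, so the derivative at
    [0] is expressed by one-sided limits. *)
Definition C1_initial (w : R -> R) (z : Rbar) (w0 : R) : Prop :=
  w 0 = w0 /\
  filterlim (fun r => (w r - w 0) / r) (at_right 0) (locally 0) /\
  filterlim (Derive w) (at_right 0) (locally 0) /\
  (forall r, 0 < r -> Rbar_lt r z -> ex_derive w r /\ continuous (Derive w) r).

Definition radial_solution (n : nat) (q alpha : R) (u : R -> R) : Prop :=
  C1_initial u p_infty alpha /\
  (forall r, 0 < r ->
     ex_derive (Derive u) r /\
     Derive (Derive u) r + (INR n - 1) / r * Derive u r + f q (u r) = 0).

(** Double zeros are only looked for at [r > 0], since [u(0) = alpha > 0]. *)
Definition double_zero (u : R -> R) (r : R) : Prop :=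
  0 < r /\ u r = 0 /\ Derive u r = 0.

Definition first_double_zero (u : R -> R) (zu : Rbar) : Prop :=
  match zu with
  | Finite z => double_zero u z /\ (forall r, r < z -> ~ double_zero u r)
  | p_infty => forall r, ~ double_zero u r
  | m_infty => False
  end.

Definition changes_sign_before (u : R -> R) (z : Rbar) : Prop :=
  exists s t, 0 < s /\ Rbar_lt s z /\ 0 < t /\ Rbar_lt t z /\ u s < 0 < u t.

Definition nodal (u : R -> R) (zu : Rbar) : Prop := changes_sign_before u zu.

Definition bound_state (u : R -> R) : Prop :=
  changes_sign_before u p_infty /\ is_lim u p_infty 0.

(** [u] has exactly [m] zeros in [(0, zu)], namely [z 1 < ... < z m]. *)
Definition zeros_before (u : R -> R) (zu : Rbar) (m : nat) (z : nat -> R) : Prop :=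
  (forall j, (1 <= j < m)%nat -> z j < z (S j)) /\
  (forall j, (1 <= j <= m)%nat -> 0 < z j /\ Rbar_lt (z j) zu) /\
  (forall r, 0 < r -> Rbar_lt r zu ->
     (u r = 0 <-> exists j, (1 <= j <= m)%nat /\ r = z j)).

(** [c 0 = 0, c 1, ..., c k] are the critical points of [u] in [[0, z (k+1))]. *)
Definition critical_points (u : R -> R) (k : nat) (z c : nat -> R) : Prop :=
  c 0%nat = 0 /\
  (forall i, (1 <= i <= k)%nat -> z i < c i < z (S i)) /\
  (forall r, 0 < r < z (S k) ->
     (Derive u r = 0 <-> exists i, (1 <= i <= k)%nat /\ r = c i)).

(** [p i] is the point of [(c (i-1), z i)] where [|u|] takes the value [y];
    it is unique because [u] is monotone there. *)
Definition level_points (u : R -> R) (k : nat) (z c : nat -> R) (y : R)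
    (p : nat -> R) : Prop :=
  forall i, (1 <= i <= S k)%nat -> c (i - 1)%nat < p i < z i /\ Rabs (u (p i)) = y.

(** [U alpha] is the solution with initial value [alpha]. *)
Definition d_alpha (U : R -> R -> R) (alpha : R) : R -> R :=
  fun r => Derive (fun beta => U beta r) alpha.

(** The standing properties of [v = d_alpha U alpha] on [[0, zu)]: the
    derivative with respect to [alpha] exists, [v] is [C^1] with [v(0) = 1],
    [v'(0) = 0], and the linearized equation holds off the zeros of [u]. *)
Definition regular_variation (n : nat) (q : R) (U : R -> R -> R) (alpha : R)
    (zu : Rbar) : Prop :=
  let u := U alpha in
  let v := d_alpha U alpha in
  (forall r, 0 <= r -> Rbar_lt r zu -> ex_derive (fun beta => U beta r) alpha) /\
  C1_initial v zu 1 /\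
  (forall r, 0 < r -> Rbar_lt r zu -> u r <> 0 ->
     ex_derive (Derive v) r /\
     Derive (Derive v) r + (INR n - 1) / r * Derive v r
       + Derive (f q) (u r) * v r = 0).

Definition Q (n : nat) (q : R) (u v : R -> R) (r : R) : R :=
  r ^ n * (Derive u r * Derive v r + f q (u r) * v r)
  + (INR n - 2) * r ^ (n - 1) * Derive u r * v r.

Definition Qn (n : nat) (q : R) (u v : R -> R) (r : R) : R :=
  Q n q u v r + INR n * r ^ (n - 1) * Derive u r * v r.

Definition M (n : nat) (u v : R -> R) (r : R) : R :=
  r ^ (n - 1) * (Derive u r * v r - u r * Derive v r).

Definition g2 (q x : R) : R := 2 * F q x / (x * f q x - 2 * F q x).

Definition Fa (q a x : R) : R := F q x - a / 2 * (x * f q x - 2 * F q x).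

Definition Ba (n : nat) (q a : R) (u v : R -> R) (r : R) : R :=
  Q n q u v r - a * M n u v r
  - 2 * Fa q a (u r) * (r ^ (n - 1) * v r / Derive u r).

Definition first_zero_in (v : R -> R) (a b tau : R) : Prop :=
  a < tau < b /\ v tau = 0 /\ (forall s, a < s < tau -> v s <> 0).

(* Main.v *)
(* By oddness of [f] one may take [u > 0], [u' < 0] on [(c, z)] with [c = c_(i-1)]
   and [z = z_i]; the hypotheses at [c] then say [v > 0 > v'].  As [f] is convex on
   the positive half-line, [f(u)] is a subsolution of the linearized equation, and
   Sturm comparison gives [f(u) v' < f'(u) u' v] as long as [v > 0] and [u >= 1].
   At [u = 1] this would be impossible with [v >= 0], so [v] vanishes earlier.

   [Ba' = - 2 Fa(u) (r^(n-1) v / u')'], and since [F(u(b)) = 0] the increment of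
   [Ba] over [(b, tau)] is affine in [a].  Its constant term is the increment of
   [Q], positive because [Q' = 2 r^(n-1) f(u) v].  The coefficient of [a] is
   nonnegative provided [M] does not grow too much on [(b, tau)].  For [n = 2] this
   follows from [Qn > 0]; for [n >= 3] it uses the comparison above together with
   [r |u'| >= (n - 2) u] on [(b, z)], which is a consequence of the energy being
   nonnegative at the zero [z]. *)
From Stdlib Require Import Reals Lra Lia Classical.
From Coquelicot Require Import Coquelicot.
Require Import Defs.
Open Scope R_scope.


(** * First zeros, signs and monotonicity of real functions *)

Lemma first_zero_of_continuous (g : R -> R) (a t : R) :
  a < t -> (forall x, a <= x <= t -> continuous g x) ->
  0 < g a -> g t <= 0 ->
  exists tau, a < tau <= t /\ g tau = 0 /\ (forall s, a <= s < tau -> 0 < g s).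
Proof.
  intros hat hg ha ht.
  (* The first zero will be the supremum of the points up to which [g] stays positive. *)
  set (E := fun s => a <= s <= t /\ forall x, a <= x <= s -> 0 < g x).
  assert (hEa : E a).
  { split; [lra|]. intros x hx. replace x with a by lra. exact ha. }
  destruct (completeness E) as [m [hm1 hm2]].
  { exists t. intros s [hs _]. lra. }
  { exists a. exact hEa. }
  assert (ham : a <= m) by (apply hm1; exact hEa).
  assert (hmt : m <= t) by (apply hm2; intros s [hs _]; lra).
  assert (hbelow : forall s, a <= s < m -> 0 < g s).
  { intros s hs. apply Rnot_le_lt. intros hgs.
    assert (m <= s); [|lra].
    apply hm2. intros y [hy1 hy2]. apply Rnot_lt_le. intros hsy.
    specialize (hy2 s ltac:(lra)). lra. }
  assert (hnear : forall P : R -> Prop, open P -> P (g m) ->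
            exists e : posreal, forall x, Rabs (x - m) < e -> P (g x)).
  { intros P hP hPm.
    destruct (hg m ltac:(lra) P (hP _ hPm)) as [e he].
    exists e. intros x hx. apply he. exact hx. }
  assert (hm0 : g m = 0).
  (* A negative value at [m] would spread to points on the left of [m], where [g] is positive; a
     positive value would put points on the right of [m] into [E]. *)
  { destruct (Rtotal_order (g m) 0) as [hneg|[h0|hpos]]; [|exact h0|].
    - destruct (hnear (fun y => y < 0) (open_lt 0) hneg) as [e he].
      destruct (Req_dec a m) as [->|hne]; [lra|].
      set (x := Rmax a (m - e / 2)).
      assert (hx : a <= x < m /\ m - e / 2 <= x).
      { unfold x. pose proof (cond_pos e).
        pose proof (Rmax_l a (m - e / 2)). pose proof (Rmax_r a (m - e / 2)).
        pose proof (Rmax_lub_lt a (m - e / 2) m ltac:(lra) ltac:(lra)). lra. }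
      specialize (he x). specialize (hbelow x ltac:(lra)).
      pose proof (cond_pos e).
      rewrite Rabs_left in he by lra. lra.
    - destruct (hnear (fun y => 0 < y) (open_gt 0) hpos) as [e he].
      pose proof (cond_pos e) as hepos.
      assert (m < t).
      { destruct (Req_dec m t) as [h|]; [rewrite h in hpos; lra|lra]. }
      set (x := Rmin t (m + e / 2)).
      assert (hx : m < x <= t /\ x <= m + e / 2).
      { unfold x.
        pose proof (Rmin_l t (m + e / 2)). pose proof (Rmin_r t (m + e / 2)).
        pose proof (Rmin_glb_lt t (m + e / 2) m ltac:(lra) ltac:(lra)). lra. }
      assert (x <= m); [|lra].
      apply hm1. split; [lra|]. intros y hy.
      destruct (Rlt_le_dec y m); [apply hbelow; lra|].
      apply he. rewrite Rabs_pos_eq by lra. lra. }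
  exists m. repeat split; [|exact hmt|exact hm0|exact hbelow].
  destruct (Req_dec a m) as [h|]; [rewrite <- h in hm0; lra|lra].
Qed.

Lemma neg_of_no_zero (g : R -> R) (a b x y : R) :
  (forall r, a < r < b -> continuous g r) ->
  (forall r, a < r < b -> g r <> 0) ->
  a < x < b -> a < y < b -> g x < 0 -> g y < 0.
Proof.
  intros hg h0 hx hy hgx. apply Rnot_le_lt. intros hgy.
  destruct (Rtotal_order x y) as [hxy|[hxy|hxy]].
  - destruct (first_zero_of_continuous (fun r => - g r) x y) as (m & hm & hm0 & _);
      [lra| |lra|lra|].
    + intros r hr. apply (continuous_opp g). apply hg. lra.
    + apply (h0 m); lra.
  - subst; lra.
  - destruct (Rle_lt_or_eq_dec 0 (g y) hgy) as [hp|he]; [|apply (h0 y); lra].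
    destruct (first_zero_of_continuous g y x) as (m & hm & hm0 & _);
      [lra| |lra|lra|].
    + intros r hr. apply hg. lra.
    + apply (h0 m); lra.
Qed.

Lemma lt_of_deriv_pos (g dg : R -> R) (a b : R) :
  a < b -> (forall r, a <= r <= b -> is_derive g r (dg r)) ->
  (forall r, a < r < b -> 0 < dg r) -> g a < g b.
Proof.
  intros hab hg hpos.
  destruct (MVT_cor2 g dg a b hab) as (r & hr & hrab).
  - intros r hr. apply is_derive_Reals. apply hg. exact hr.
  - pose proof (Rmult_lt_0_compat _ (b - a) (hpos r hrab) ltac:(lra)). lra.
Qed.

Lemma le_of_deriv_nonneg (g dg : R -> R) (a b : R) :
  a <= b -> (forall r, a <= r <= b -> is_derive g r (dg r)) ->
  (forall r, a < r < b -> 0 <= dg r) -> g a <= g b.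
Proof.
  intros hab hg hpos.
  destruct (Req_dec a b) as [->|hne]; [lra|].
  destruct (MVT_cor2 g dg a b ltac:(lra)) as (r & hr & hrab).
  - intros r hr. apply is_derive_Reals. apply hg. exact hr.
  - pose proof (Rmult_le_pos _ (b - a) (hpos r hrab) ltac:(lra)). lra.
Qed.

(** Separates the computation of a derivative, done with [eapply], from the algebraic simplification
    of its value. *)
Lemma is_derive_eq (g : R -> R) (x l l' : R) :
  is_derive g x l -> l = l' -> is_derive g x l'.
Proof. intros h <-. exact h. Qed.

(** * Powers and the nonlinearity on the positive half-line *)

Lemma is_derive_Rpower (p x : R) :
  0 < x -> is_derive (fun y => Rpower y p) x (p * Rpower x p / x).
Proof.
  intros hx. apply is_derive_Reals.
  replace (p * Rpower x p / x) with (p * Rpower x (p - 1)).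
  - now apply derivable_pt_lim_power.
  - unfold Rminus. rewrite Rpower_plus, Rpower_Ropp, Rpower_1 by lra.
    unfold Rdiv. ring.
Qed.

Lemma Derive_Rpower (p x : R) :
  0 < x -> Derive (fun y : R => Rpower y p) x = p * Rpower x p / x.
Proof. intros hx. apply is_derive_unique. now apply is_derive_Rpower. Qed.

Lemma Rpower_mul_self (p x : R) : 0 < x -> Rpower x p * x = Rpower x (p + 1).
Proof. intros hx. rewrite Rpower_plus, Rpower_1 by lra. ring. Qed.

Lemma Rpower_pos (x p : R) : 0 < Rpower x p.
Proof. apply exp_pos. Qed.

Lemma abs_pow_pos (x p : R) : 0 < x -> abs_pow x p = Rpower x p.
Proof.
  intros hx. unfold abs_pow. destruct (Req_EM_T x 0); [lra|].
  now rewrite Rabs_pos_eq by lra.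
Qed.

Lemma abs_pow_opp (x p : R) : abs_pow (- x) p = abs_pow x p.
Proof.
  unfold abs_pow. rewrite Rabs_Ropp.
  destruct (Req_EM_T (- x) 0), (Req_EM_T x 0); try lra; reflexivity.
Qed.

Lemma f_opp (q x : R) : f q (- x) = - f q x.
Proof. unfold f. rewrite abs_pow_opp. ring. Qed.

Lemma F_opp (q x : R) : F q (- x) = F q x.
Proof. unfold F. rewrite abs_pow_opp. ring. Qed.

(** For positive arguments everything is written in terms of the single power [Rpower x (q - 1)],
    which [field] and [lra] can treat as an atom. *)
Lemma f_pos_eq (q x : R) : 0 < x -> f q x = x - Rpower x (q - 1).
Proof.
  intros hx. unfold f. rewrite abs_pow_pos, Rpower_mul_self by lra.
  do 2 f_equal. ring.
Qed.

Lemma F_pos_eq (q x : R) :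
  0 < x -> F q x = x ^ 2 / 2 - x * Rpower x (q - 1) / q.
Proof.
  intros hx. unfold F. rewrite abs_pow_pos by lra.
  replace (Rpower x q) with (Rpower x (q - 1) * x).
  - unfold Rdiv. ring.
  - rewrite Rpower_mul_self by lra. f_equal. ring.
Qed.

Lemma locally_pos (x : R) : 0 < x -> locally x (fun y => 0 < y).
Proof. intros hx. exact (open_gt 0 x hx). Qed.

Lemma is_derive_f (q x : R) :
  0 < x -> is_derive (f q) x (1 - (q - 1) * Rpower x (q - 1) / x).
Proof.
  intros hx.
  apply (is_derive_ext_loc (fun y => y - Rpower y (q - 1))).
  - refine (filter_imp _ _ _ (locally_pos x hx)). intros y hy.
    now rewrite f_pos_eq.
  - apply @is_derive_minus; [apply @is_derive_id | now apply is_derive_Rpower].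
Qed.

Lemma Derive_f_opp (q x : R) : 0 < x -> Derive (f q) (- x) = Derive (f q) x.
Proof.
  intros hx. pose proof (is_derive_f q x hx) as h.
  rewrite (is_derive_unique _ _ _ h).
  apply is_derive_unique.
  apply (is_derive_ext (fun y => - f q (- y))).
  - intros y. now rewrite f_opp, Ropp_involutive.
  - rewrite <- (Ropp_involutive x) in h at 1.
    eapply is_derive_eq.
    + apply @is_derive_opp. apply (is_derive_comp (f q) Ropp).
      * exact h.
      * apply @is_derive_opp. apply @is_derive_id.
    + cbv [opp scal one mult]; simpl; cbv [mult]; simpl. ring.
Qed.

Lemma is_derive_F (q x : R) : 0 < q -> 0 < x -> is_derive (F q) x (f q x).
Proof.
  intros hq hx.
  apply (is_derive_ext_loc (fun y => y ^ 2 / 2 - y * Rpower y (q - 1) / q)).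
  - refine (filter_imp _ _ _ (locally_pos x hx)). intros y hy.
    now rewrite F_pos_eq.
  - pose proof (is_derive_Rpower (q - 1) x hx) as h.
    auto_derive.
    + eexists; exact h.
    + rewrite (Derive_Rpower (q - 1) x hx), f_pos_eq by lra. field. lra.
Qed.

(** This is the equation [F q (alpha_star q) = 0] solved for the power. *)
Lemma alpha_star_power (q : R) :
  1 < q < 2 -> Rpower (alpha_star q) (q - 1) = q / 2 * alpha_star q.
Proof.
  intros hq. unfold alpha_star. set (y := Rpower (2 / q) _).
  assert (hy : 0 < y) by apply Rpower_pos.
  replace (q - 1) with (- (2 - q) + 1) by ring.
  rewrite <- Rpower_mul_self by exact hy. f_equal.
  unfold y. rewrite Rpower_mult.
  replace (1 / (2 - q) * - (2 - q)) with (- (1)) by (field; lra).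
  rewrite Rpower_Ropp, Rpower_1.
  - field. lra.
  - apply Rdiv_lt_0_compat; lra.
Qed.

Lemma alpha_star_gt_1 (q : R) : 1 < q < 2 -> 1 < alpha_star q.
Proof.
  intros hq. unfold alpha_star. rewrite <- (Rpower_O (2 / q)) at 1.
  - apply Rpower_lt.
    + rewrite <- Rlt_div_r; lra.
    + apply Rdiv_lt_0_compat; lra.
  - apply Rdiv_lt_0_compat; lra.
Qed.

Lemma Rpower_1_l (p : R) : Rpower 1 p = 1.
Proof. unfold Rpower. rewrite ln_1, Rmult_0_r. apply exp_0. Qed.

Lemma f_1 (q : R) : f q 1 = 0.
Proof. rewrite f_pos_eq by lra. rewrite Rpower_1_l. ring. Qed.

Lemma f_gt_0 (q x : R) : 1 < q < 2 -> 1 < x -> 0 < f q x.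
Proof.
  intros hq hx. rewrite f_pos_eq by lra.
  assert (h : Rpower x (q - 1) < Rpower x 1) by (apply Rpower_lt; lra).
  rewrite Rpower_1 in h by lra. lra.
Qed.

(** Splitting [x] this way reduces sign questions for [f] and [F] to comparing [Rpower x (2 - q)],
    which is increasing in [x], with a constant. *)
Lemma Rpower_compl (q x : R) :
  0 < x -> Rpower x (q - 1) * Rpower x (2 - q) = x.
Proof.
  intros hx. rewrite <- Rpower_plus. replace (q - 1 + (2 - q)) with 1 by ring.
  now apply Rpower_1.
Qed.

Lemma f_le_0 (q x : R) : 1 < q < 2 -> 0 < x <= 1 -> f q x <= 0.
Proof.
  intros hq hx. rewrite f_pos_eq by lra.
  pose proof (Rpower_compl q x ltac:(lra)) as h.
  pose proof (Rle_Rpower_l x 1 (2 - q) ltac:(lra) hx) as h1.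
  rewrite Rpower_1_l in h1. pose proof (Rpower_pos x (q - 1)) as hw.
  pose proof (Rmult_le_pos _ (1 - Rpower x (2 - q)) (Rlt_le _ _ hw) ltac:(lra)). lra.
Qed.

(** For [x >= 1] the power [x^(q-1)] is at most [x], and the factor [q - 1] is less than 1. *)
Lemma f_deriv_pos (q x : R) :
  1 < q < 2 -> 1 <= x -> 0 < 1 - (q - 1) * Rpower x (q - 1) / x.
Proof.
  intros hq hx.
  assert (h : Rpower x (q - 1) <= x).
  { destruct (Req_dec x 1) as [->|hne]; [rewrite Rpower_1_l; lra|].
    pose proof (f_gt_0 q x hq ltac:(lra)) as h. rewrite f_pos_eq in h by lra. lra. }
  assert ((q - 1) * Rpower x (q - 1) / x < 1); [|lra].
  apply Rlt_div_l; [lra|].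
  pose proof (Rmult_lt_0_compat (2 - q) _ ltac:(lra) (Rpower_pos x (q - 1))). lra.
Qed.

Lemma F_factor (q x : R) :
  1 < q < 2 -> 0 < x ->
  F q x = x * Rpower x (q - 1) / 2 * (Rpower x (2 - q) - Rpower (alpha_star q) (2 - q)).
Proof.
  intros hq hx. rewrite F_pos_eq by exact hx.
  pose proof (Rpower_compl q x hx) as h.
  replace (Rpower (alpha_star q) (2 - q)) with (2 / q).
  - replace (x ^ 2) with (x * (Rpower x (q - 1) * Rpower x (2 - q)))
      by (rewrite h; ring).
    field. lra.
  - unfold alpha_star. rewrite Rpower_mult.
    replace (1 / (2 - q) * (2 - q)) with 1 by (field; lra).
    rewrite Rpower_1; [reflexivity|]. apply Rdiv_lt_0_compat; lra.
Qed.

Lemma F_lt_0 (q x : R) : 1 < q < 2 -> 0 < x < alpha_star q -> F q x < 0.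
Proof.
  intros hq hx. rewrite F_factor by lra.
  pose proof (Rlt_Rpower_l x (alpha_star q) (2 - q) ltac:(lra) hx).
  pose proof (Rmult_lt_0_compat _ _ (proj1 hx) (Rpower_pos x (q - 1))). nra.
Qed.

Lemma F_ge_0 (q x : R) : 1 < q < 2 -> alpha_star q <= x -> 0 <= F q x.
Proof.
  intros hq hx. pose proof (alpha_star_gt_1 q hq).
  rewrite F_factor by lra.
  pose proof (Rle_Rpower_l (alpha_star q) x (2 - q) ltac:(lra) ltac:(split; lra)).
  pose proof (Rmult_lt_0_compat x _ ltac:(lra) (Rpower_pos x (q - 1))). nra.
Qed.

Lemma F_0 (q : R) : F q 0 = 0.
Proof. unfold F, abs_pow. destruct (Req_EM_T 0 0); lra. Qed.

Lemma F_alpha_star (q : R) : 1 < q < 2 -> F q (alpha_star q) = 0.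
Proof.
  intros hq. pose proof (alpha_star_gt_1 q hq). rewrite F_factor by lra. ring.
Qed.

(** The quadratic terms cancel. What remains is a single power, with positive coefficient when
    [q < 2]; it is the denominator in [g2]. *)
Lemma xf_sub_2F (q x : R) :
  1 < q -> 0 < x -> x * f q x - 2 * F q x = (2 / q - 1) * x * Rpower x (q - 1).
Proof. intros hq hx. rewrite f_pos_eq, F_pos_eq by lra. field. lra. Qed.

Lemma g2_ge_0 (q x : R) : 1 < q < 2 -> alpha_star q <= x -> 0 <= g2 q x.
Proof.
  intros hq hx. pose proof (alpha_star_gt_1 q hq).
  unfold g2. rewrite xf_sub_2F by lra.
  apply Rdiv_le_0_compat.
  - pose proof (F_ge_0 q x hq hx). lra.
  - assert (1 < 2 / q) by (apply Rlt_div_r; lra).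
    repeat apply Rmult_lt_0_compat; try lra. apply Rpower_pos.
Qed.

(* After dividing by [x], with [y = x / alpha_star q], this is
   [1 <= q / 2 * y ^ (q - 2) + (1 - q / 2) * y], which follows from
   [exp t >= 1 + t] since the resulting coefficient of [ln y <= 0] is negative. *)
Lemma f_le_square (q x : R) :
  1 < q < 2 -> 0 < x <= alpha_star q ->
  f q x <= (2 - q) / (2 * alpha_star q) * x ^ 2.
Proof.
  intros hq hx. pose proof (alpha_star_gt_1 q hq) as hal.
  pose proof (alpha_star_power q hq) as hpow.
  set (al := alpha_star q) in *.
  assert (hy : 0 < x / al <= 1).
  { split; [apply Rdiv_lt_0_compat; lra|]. apply Rle_div_l; lra. }
  assert (hxy : x = x / al * al) by (field; lra).
  set (y := x / al) in *.
  assert (hln : ln y <= 0) by (rewrite <- ln_1; apply ln_le; lra).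
  assert (h1 : 1 + ln y <= y).
  { rewrite <- (exp_ln y) at 2 by lra. apply exp_ineq1_le. }
  assert (h2 : (1 + (q - 2) * ln y) * y <= Rpower y (q - 1)).
  { replace (q - 1) with (q - 2 + 1) by ring. rewrite <- Rpower_mul_self by lra.
    apply Rmult_le_compat_r; [lra|]. apply exp_ineq1_le. }
  rewrite f_pos_eq by lra. rewrite hxy, <- Rpower_mult_distr, hpow by lra.
  replace ((2 - q) / (2 * al) * (y * al) ^ 2)
    with (al * ((1 - q / 2) * (y * y))) by (field; lra).
  replace (y * al - Rpower y (q - 1) * (q / 2 * al))
    with (al * (y - q / 2 * Rpower y (q - 1))) by ring.
  apply Rmult_le_compat_l; [lra|].
  (* Up to the factor [al], the right side minus the left side is half of this first nonnegative
     term plus the next two. *)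
  assert (0 <= - ln y * y * ((2 - q) * (q - 1))).
  { apply Rmult_le_pos; [apply Rmult_le_pos; lra|].
    apply Rmult_le_pos; lra. }
  assert (0 <= (1 - q / 2) * y * (y - (1 + ln y))).
  { apply Rmult_le_pos; [apply Rmult_le_pos|]; lra. }
  assert (0 <= q / 2 * (Rpower y (q - 1) - (1 + (q - 2) * ln y) * y)).
  { apply Rmult_le_pos; lra. }
  lra.
Qed.

(** On [[0, 1]] the power [x^(q-1)] is at most 1. This crude bound serves near an end zero of [u],
    where it replaces [F(u)] by an expression that is differentiable up to the zero. *)
Lemma F_ge_opp (q x : R) : 1 < q < 2 -> 0 <= x <= 1 -> - x <= F q x.
Proof.
  intros hq hx. destruct (Req_dec x 0) as [->|hne]; [rewrite F_0; lra|].
  rewrite F_pos_eq by lra.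
  pose proof (Rle_Rpower_l x 1 (q - 1) ltac:(lra) ltac:(split; lra)) as h.
  rewrite Rpower_1_l in h. pose proof (Rpower_pos x (q - 1)).
  assert (/ q < 1) by (rewrite <- Rinv_1; apply Rinv_lt_contravar; lra).
  assert (0 < / q) by (apply Rinv_0_lt_compat; lra).
  unfold Rdiv. assert (x * Rpower x (q - 1) <= x) by nra.
  assert (0 < x * Rpower x (q - 1)) by (apply Rmult_lt_0_compat; lra).
  nra.
Qed.


(** * Differentiation rules, and the setting of a positive arch *)

Lemma is_derive_Rplus (g h : R -> R) (x a b : R) :
  is_derive g x a -> is_derive h x b -> is_derive (fun t => g t + h t) x (a + b).
Proof. apply (is_derive_plus g h). Qed.

Lemma is_derive_Rminus (g h : R -> R) (x a b : R) :
  is_derive g x a -> is_derive h x b -> is_derive (fun t => g t - h t) x (a - b).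
Proof. apply (is_derive_minus g h). Qed.

Lemma is_derive_Rmult (g h : R -> R) (x a b : R) :
  is_derive g x a -> is_derive h x b ->
  is_derive (fun t => g t * h t) x (a * h x + g x * b).
Proof. intros hg hh. apply (is_derive_mult g h x a b hg hh). exact Rmult_comm. Qed.

Lemma is_derive_Rdiv (g h : R -> R) (x a b : R) :
  is_derive g x a -> is_derive h x b -> h x <> 0 ->
  is_derive (fun t => g t / h t) x ((a * h x - g x * b) / h x ^ 2).
Proof. intros hg hh hx. now apply is_derive_div. Qed.

Lemma is_derive_Rcomp (g h : R -> R) (x a b : R) :
  is_derive g (h x) a -> is_derive h x b -> is_derive (fun t => g (h t)) x (a * b).
Proof.
  intros hg hh. rewrite Rmult_comm. exact (is_derive_comp g h x a b hg hh).
Qed.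

Lemma is_derive_power (m : nat) (x : R) :
  0 < x -> is_derive (fun t => t ^ m) x (INR m * x ^ m / x).
Proof.
  intros hx. auto_derive; [exact I|].
  destruct m as [|m]; simpl pred; [simpl; field; lra|].
  rewrite <- tech_pow_Rmult. field. lra.
Qed.

(** [eassumption] comes before the arithmetic rules, so a compound function such as [f q (u t)] is
    differentiated as a whole once its derivative has been posed as a hypothesis. *)
Ltac deriv :=
  repeat first
    [ match goal with |- is_derive (fun _ => ?k) _ _ => apply (is_derive_const k) end
    | match goal with |- is_derive (fun t => t) _ _ => apply is_derive_id end
    | eassumption
    | match goal with
      | |- is_derive (fun t => _ + _) _ _ => apply is_derive_Rplus
      | |- is_derive (fun t => _ - _) _ _ => apply is_derive_Rminus
      | |- is_derive (fun t => _ * _) _ _ => apply is_derive_Rmult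
      | |- is_derive (fun t => _ / _) _ _ => apply is_derive_Rdiv
      end ].

(** The normalized situation between a critical point [c] and the next zero [z]. The data on [u]
    include [z], those on [v] do not: [z] may be the double zero, and the linearized equation is
    only available off the zeros of [u]. *)
Record positive_arch (n : nat) (q : R) (u v : R -> R) (c z : R) : Prop := {
  arch_dim : (2 <= n)%nat;
  arch_exponent : 1 < q < 2;
  arch_interval : 0 < c < z;
  arch_pos : forall r, c <= r < z -> 0 < u r;
  arch_end : u z = 0;
  arch_crit : Derive u c = 0;
  arch_decr : forall r, c < r < z -> Derive u r < 0;
  arch_u1 : forall r, c <= r <= z -> ex_derive u r;
  arch_u2 : forall r, c <= r <= z -> ex_derive (Derive u) r;
  arch_u_eq : forall r, c <= r <= z ->
    Derive (Derive u) r + (INR n - 1) / r * Derive u r + f q (u r) = 0;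
  arch_v1 : forall r, c <= r < z -> ex_derive v r;
  arch_v2 : forall r, c <= r < z -> ex_derive (Derive v) r;
  arch_v_eq : forall r, c <= r < z ->
    Derive (Derive v) r + (INR n - 1) / r * Derive v r
      + Derive (f q) (u r) * v r = 0
}.

(** * Derivative identities along an arch *)

Definition df (q x : R) : R := 1 - (q - 1) * Rpower x (q - 1) / x.

Lemma x_df_sub_f (q x : R) : 0 < x -> x * df q x - f q x = (2 - q) * Rpower x (q - 1).
Proof. intros hx. rewrite f_pos_eq by exact hx. unfold df. field. lra. Qed.

Lemma is_derive_df (q x : R) :
  0 < x -> is_derive (df q) x ((q - 1) * (2 - q) * Rpower x (q - 1) / x ^ 2).
Proof.
  intros hx. pose proof (is_derive_Rpower (q - 1) x hx).
  unfold df. eapply is_derive_eq; [deriv; lra|].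
  cbv [zero one]; simpl. field. lra.
Qed.

Lemma is_derive_Fa (q a x : R) :
  0 < q -> 0 < x ->
  is_derive (Fa q a) x (f q x - a / 2 * (x * df q x - f q x)).
Proof.
  intros hq hx. pose proof (is_derive_f q x hx). pose proof (is_derive_F q x hq hx).
  unfold Fa. eapply is_derive_eq; [deriv|].
  cbv [zero one]; simpl. fold (df q x). field.
Qed.


Lemma pow_pred (n : nat) (r : R) : (2 <= n)%nat -> r ^ n = r * r ^ (n - 1).
Proof. intros hn. rewrite tech_pow_Rmult. f_equal. lia. Qed.

(** Collects the derivatives that [deriv] looks up, with the second derivatives of [u] and [v]
    already eliminated through the two equations. *)
Lemma arch_derivatives n q u v c z r :
  positive_arch n q u v c z -> c <= r < z ->
  0 < r /\ 0 < u r /\ 0 < r ^ (n - 1) /\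
  is_derive u r (Derive u r) /\
  is_derive (Derive u) r (- (INR n - 1) / r * Derive u r - f q (u r)) /\
  is_derive v r (Derive v r) /\
  is_derive (Derive v) r (- (INR n - 1) / r * Derive v r - df q (u r) * v r) /\
  is_derive (fun t => f q (u t)) r (df q (u r) * Derive u r) /\
  is_derive (fun t => t ^ (n - 1)) r ((INR n - 1) * r ^ (n - 1) / r).
Proof.
  intros H hr.
  pose proof (arch_dim _ _ _ _ _ _ H) as hn.
  pose proof (arch_interval _ _ _ _ _ _ H) as hcz.
  pose proof (arch_pos _ _ _ _ _ _ H r hr) as hur.
  assert (hr0 : 0 < r) by lra.
  pose proof (Derive_correct _ _ (arch_u1 _ _ _ _ _ _ H r ltac:(lra))) as hu.
  split; [exact hr0|].
  split; [exact hur|].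
  split; [now apply pow_lt|].
  split; [exact hu|].
  split; [|split; [|split; [|split]]].
  - eapply is_derive_eq.
    + apply Derive_correct, (arch_u2 _ _ _ _ _ _ H r). lra.
    + pose proof (arch_u_eq _ _ _ _ _ _ H r ltac:(lra)).
      replace (- (INR n - 1) / r * Derive u r) with (- ((INR n - 1) / r * Derive u r))
        by (unfold Rdiv; ring). lra.
  - apply Derive_correct, (arch_v1 _ _ _ _ _ _ H r hr).
  - eapply is_derive_eq.
    + apply Derive_correct, (arch_v2 _ _ _ _ _ _ H r hr).
    + pose proof (arch_v_eq _ _ _ _ _ _ H r hr) as h.
      rewrite (is_derive_unique _ _ _ (is_derive_f q (u r) hur)) in h.
      fold (df q (u r)) in h.
      replace (- (INR n - 1) / r * Derive v r) with (- ((INR n - 1) / r * Derive v r))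
        by (unfold Rdiv; ring). lra.
  - apply is_derive_Rcomp; [exact (is_derive_f q (u r) hur)|exact hu].
  - eapply is_derive_eq; [now apply is_derive_power|].
    now rewrite minus_INR by lia.
Qed.

Ltac arch_at H r hr :=
  destruct (arch_derivatives _ _ _ _ _ _ r H hr)
    as (hr0 & hur & hp & du & du1 & dv & dv1 & dfu & dp);
  try pose proof (arch_dim _ _ _ _ _ _ H) as hn;
  try pose proof (arch_exponent _ _ _ _ _ _ H) as hq.

(** [Q] is [r^(n-1)] times the Wronskian [w v' - w' v] with [w = r u'], and the linearized operator
    maps [r u'] to [- 2 f(u)]. *)
Lemma is_derive_Q n q u v c z r :
  positive_arch n q u v c z -> c <= r < z ->
  is_derive (Q n q u v) r (2 * r ^ (n - 1) * f q (u r) * v r).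
Proof.
  intros H hr. arch_at H r hr.
  apply (is_derive_ext (fun t => t * t ^ (n - 1) * (Derive u t * Derive v t + f q (u t) * v t)
    + (INR n - 2) * t ^ (n - 1) * Derive u t * v t)).
  { intros t. unfold Q. now rewrite (pow_pred n t). }
  eapply is_derive_eq; [deriv|].
  cbv [zero one]; simpl. field. lra.
Qed.

(** [M] is the weighted Wronskian of [u] and [v], and the linearized operator maps [u] to
    [u f'(u) - f(u)]. *)
Lemma is_derive_M n q u v c z r :
  positive_arch n q u v c z -> c <= r < z ->
  is_derive (M n u v) r (r ^ (n - 1) * (u r * df q (u r) - f q (u r)) * v r).
Proof.
  intros H hr. arch_at H r hr. unfold M.
  eapply is_derive_eq; [deriv|].
  cbv beta. field. lra.
Qed.

(** The weighted Wronskian of [f(u)] and [v]: the linearized operator maps [f(u)] to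
    [f''(u) u'^2]. *)
Lemma is_derive_fv n q u v c z r :
  positive_arch n q u v c z -> c <= r < z ->
  is_derive (fun t => t ^ (n - 1) *
      (df q (u t) * Derive u t * v t - f q (u t) * Derive v t)) r
    (r ^ (n - 1) * ((q - 1) * (2 - q) * Rpower (u r) (q - 1) / u r ^ 2)
       * Derive u r ^ 2 * v r).
Proof.
  intros H hr. arch_at H r hr.
  pose proof (is_derive_Rcomp _ u r _ _ (is_derive_df q (u r) hur) du).
  eapply is_derive_eq; [deriv|].
  cbv beta. field. lra.
Qed.

(** Eliminating [u''] turns the numerator of the quotient rule into [Qn / r]. *)
Lemma is_derive_ratio n q u v c z r :
  positive_arch n q u v c z -> c < r < z ->
  is_derive (fun t => t ^ (n - 1) * v t / Derive u t) r
    (Qn n q u v r / (r * Derive u r ^ 2)).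
Proof.
  intros H hr. assert (hr' : c <= r < z) by lra. arch_at H r hr'.
  pose proof (arch_decr _ _ _ _ _ _ H r hr).
  eapply is_derive_eq; [deriv; lra|].
  cbv beta. unfold Qn, Q. rewrite (pow_pred n r) by exact hn. field. lra.
Qed.

(** [Ba] is built so that the derivative of [Q - a M] cancels against the term with [(Fa(u))']; only
    the derivative of the ratio [r^(n-1) v / u'] survives. *)
Lemma is_derive_Ba n q a u v c z r :
  positive_arch n q u v c z -> c < r < z ->
  is_derive (Ba n q a u v) r
    (- 2 * Fa q a (u r) * (Qn n q u v r / (r * Derive u r ^ 2))).
Proof.
  intros H hr. assert (hr' : c <= r < z) by lra. arch_at H r hr'.
  pose proof (arch_decr _ _ _ _ _ _ H r hr).
  pose proof (is_derive_Q _ _ _ _ _ _ r H hr').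
  pose proof (is_derive_M _ _ _ _ _ _ r H hr').
  pose proof (is_derive_ratio _ _ _ _ _ _ r H hr).
  pose proof (is_derive_Rcomp _ u r _ _ (is_derive_Fa q a (u r) ltac:(lra) hur) du).
  unfold Ba. eapply is_derive_eq; [deriv|].
  cbv [zero one]; simpl. field. lra.
Qed.


(** * Monotonicity of [u] and the first zero of [v] on an arch *)

Lemma continuous_of_is_derive (g : R -> R) (x l : R) : is_derive g x l -> continuous g x.
Proof. intros h. exact (ex_derive_continuous g x (ex_intro _ l h)). Qed.

Lemma arch_u_lt n q u v c z r s :
  positive_arch n q u v c z -> c <= r -> r < s -> s <= z -> u s < u r.
Proof.
  intros H hr hrs hs.
  apply Ropp_lt_cancel.
  apply (lt_of_deriv_pos (fun t => - u t) (fun t => - Derive u t)).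
  - exact hrs.
  - intros t ht. apply (is_derive_opp u).
    apply Derive_correct, (arch_u1 _ _ _ _ _ _ H). lra.
  - intros t ht. pose proof (arch_decr _ _ _ _ _ _ H t ltac:(lra)). lra.
Qed.

(** Since [u'(c) = 0], one has [Q(c) = c^n f(u(c)) v(c)] and [M(c) = - c^(n-1) u(c) v'(c)], with
    [f(u(c)) > 0]. *)
Lemma arch_initial_signs n q u v c z :
  positive_arch n q u v c z -> 1 < u c ->
  0 < Q n q u v c -> 0 < M n u v c -> 0 < v c /\ Derive v c < 0.
Proof.
  intros H huc hQ hM.
  pose proof (arch_interval _ _ _ _ _ _ H) as hcz.
  assert (hc : c <= c < z) by lra. arch_at H c hc.
  pose proof (f_gt_0 q (u c) hq huc) as hf.
  unfold Q in hQ. unfold M in hM.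
  rewrite (arch_crit _ _ _ _ _ _ H) in hQ, hM.
  assert (hcn : 0 < c ^ n) by now apply pow_lt.
  split.
  - apply Rnot_le_lt. intros hv. apply (Rlt_not_le _ _ hQ).
    pose proof (Rmult_le_pos _ (- v c) (Rlt_le _ _ (Rmult_lt_0_compat _ _ hcn hf)) ltac:(lra)).
    lra.
  - apply Rnot_le_lt. intros hv. apply (Rlt_not_le _ _ hM).
    pose proof (Rmult_le_pos _ _ (Rlt_le _ _ (Rmult_lt_0_compat _ _ hp hur)) hv).
    lra.
Qed.

(* Sturm comparison of [v] with [f(u)], which is a subsolution of the linearized
   equation because [f] is convex on the positive half-line. *)
Lemma arch_fv_pos n q u v c z s :
  positive_arch n q u v c z -> 1 < u c -> Derive v c < 0 ->
  c < s < z -> (forall r, c < r < s -> 0 < v r) ->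
  0 < df q (u s) * Derive u s * v s - f q (u s) * Derive v s.
Proof.
  intros H huc hvc hs hv.
  pose proof (arch_interval _ _ _ _ _ _ H) as hcz.
  assert (hc : c <= c < z) by lra. arch_at H c hc.
  assert (hle := le_of_deriv_nonneg _ _ c s ltac:(lra)
    (fun r hr => is_derive_fv n q u v c z r H ltac:(lra))).
  cbv beta in hle. rewrite (arch_crit _ _ _ _ _ _ H) in hle.
  pose proof (f_gt_0 q (u c) hq huc) as hf.
  (* The nondecreasing quantity starts at [- c^(n-1) f(u(c)) v'(c) > 0]. *)
  pose proof (Rmult_lt_0_compat _ (- Derive v c) (Rmult_lt_0_compat _ _ hp hf) ltac:(lra)).
  assert (hsp : 0 < s ^ (n - 1)) by (apply pow_lt; lra).
  apply (Rmult_lt_reg_l _ _ _ hsp). rewrite Rmult_0_r.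
  refine (Rlt_le_trans _ _ _ _ (hle _)); [lra|].
  intros r hr.
  pose proof (arch_pos _ _ _ _ _ _ H r ltac:(lra)).
  assert (0 < r ^ (n - 1)) by (apply pow_lt; lra).
  apply Rmult_le_pos; [apply Rmult_le_pos|].
  - apply Rmult_le_pos; [lra|]. unfold Rdiv.
    apply Rmult_le_pos; [|left; apply Rinv_0_lt_compat; now apply pow_lt].
    pose proof (Rpower_pos (u r) (q - 1)).
    apply Rmult_le_pos; [apply Rmult_le_pos|]; lra.
  - apply pow2_ge_0.
  - left. now apply hv.
Qed.

Lemma arch_v_continuous n q u v c z r :
  positive_arch n q u v c z -> c <= r < z -> continuous v r.
Proof. intros H hr. exact (ex_derive_continuous v r (arch_v1 _ _ _ _ _ _ H r hr)). Qed.

(** If [v] is positive on [(c, rho)], the comparison at [rho], where [f(1) = 0], reads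
    [f'(1) u'(rho) v(rho) > 0] and forces [v(rho) < 0]. Thus [v] reaches a nonpositive value
    strictly before [rho] in every case. *)
Lemma arch_first_zero n q u v c z rho :
  positive_arch n q u v c z -> 1 < u c -> 0 < v c -> Derive v c < 0 ->
  c < rho < z -> u rho = 1 ->
  exists tau, first_zero_in v c rho tau.
Proof.
  intros H huc hvc hv1c hrho hurho.
  pose proof (arch_exponent _ _ _ _ _ _ H) as hq.
  assert (hneg : v rho < 0 \/ exists s, c < s < rho /\ v s <= 0).
  { destruct (Rlt_le_dec (v rho) 0) as [|hvr]; [now left|right].
    destruct (classic (exists s, c < s < rho /\ v s <= 0)) as [h|h];
      [exact h|exfalso].
    assert (hv : forall r, c < r < rho -> 0 < v r).
    { intros r hr. apply Rnot_le_lt. intros hvs. apply h. now exists r. }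
    pose proof (arch_fv_pos _ _ _ _ _ _ rho H huc hv1c hrho hv) as hT.
    pose proof (arch_decr _ _ _ _ _ _ H rho hrho) as hu1.
    pose proof (f_deriv_pos q 1 hq ltac:(lra)) as hd. fold (df q 1) in hd.
    rewrite hurho, f_1 in hT.
    pose proof (Rmult_le_pos _ _ (Rlt_le _ _ (Rmult_lt_0_compat _ (- Derive u rho) hd
      ltac:(lra))) hvr).
    lra. }
  assert (hs : exists s, c < s < rho /\ v s <= 0).
  { destruct hneg as [hvr|]; [|assumption].
    destruct (first_zero_of_continuous v c rho) as (m & hm & hm0 & _); [lra| |lra|lra|].
    - intros x hx. apply (arch_v_continuous _ _ _ _ _ _ x H). lra.
    - exists m. split; [|lra].
      destruct (Req_dec m rho) as [h|]; [rewrite h in hm0; lra|lra]. }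
  destruct hs as (s & hs & hvs).
  destruct (first_zero_of_continuous v c s) as (m & hm & hm0 & hmpos); [lra| |lra|lra|].
  - intros x hx. apply (arch_v_continuous _ _ _ _ _ _ x H). lra.
  - exists m. split; [lra|]. split; [exact hm0|].
    intros x hx. pose proof (hmpos x ltac:(lra)). lra.
Qed.

Lemma arch_v_pos n q u v c z rho tau r :
  positive_arch n q u v c z -> 0 < v c -> rho < z ->
  first_zero_in v c rho tau -> c <= r < tau -> 0 < v r.
Proof.
  intros H hvc hrho (htau & _ & hno) hr. apply Rnot_le_lt. intros hvr.
  assert (c < r) by (destruct (Req_dec c r) as [h|]; [rewrite h in hvc; lra|lra]).
  destruct (first_zero_of_continuous v c r) as (m & hm & hm0 & _); [lra| |lra|lra|].
  - intros x hx. apply (arch_v_continuous _ _ _ _ _ _ x H). lra.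
  - apply (hno m); lra.
Qed.

(** * The slope bound [r |u'| >= (n - 2) u] beyond the level [alpha_star q] *)

Lemma arch_end_slope n q u v c z : positive_arch n q u v c z -> Derive u z <= 0.
Proof.
  intros H. pose proof (arch_interval _ _ _ _ _ _ H) as hcz.
  apply Rnot_lt_le. intros hz.
  assert (hmid : c < (c + z) / 2 < z) by lra.
  pose proof (arch_decr _ _ _ _ _ _ H _ hmid).
  destruct (first_zero_of_continuous (fun t => - Derive u t) ((c + z) / 2) z)
    as (m & hm & hm0 & _); [lra| |lra|lra|].
  - intros x hx. apply (continuous_opp (Derive u)).
    apply (ex_derive_continuous (Derive u)), (arch_u2 _ _ _ _ _ _ H). lra.
  - destruct (Req_dec m z) as [h|]; [rewrite h in hm0; lra|].
    pose proof (arch_decr _ _ _ _ _ _ H m ltac:(lra)). lra.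
Qed.

(** The monotonicity of [(n - 2) u + r u'] is thus governed by the position of [u] relative to 1.
    Only the equation of [u] enters, so the end point [z] is included. *)
Lemma is_derive_scaling n q u v c z r :
  positive_arch n q u v c z -> c <= r <= z ->
  is_derive (fun t => (INR n - 2) * u t + t * Derive u t) r (- r * f q (u r)).
Proof.
  intros H hr. pose proof (arch_interval _ _ _ _ _ _ H) as hcz.
  pose proof (Derive_correct _ _ (arch_u1 _ _ _ _ _ _ H r hr)).
  pose proof (Derive_correct _ _ (arch_u2 _ _ _ _ _ _ H r hr)).
  pose proof (arch_u_eq _ _ _ _ _ _ H r hr) as he.
  eapply is_derive_eq; [deriv|]. cbv [zero one]; simpl.
  replace (f q (u r)) with (- (Derive (Derive u) r + (INR n - 1) / r * Derive u r)) by lra.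
  field. lra.
Qed.

(* If [y := (n - 2) u + r u'] were positive at [b], it would vanish at some [r1]
   in [(b, rho)] and be nonpositive afterwards. Then the scaled energy
   [r^2 (u'^2 + 2 F(u)) - (n - 2)^2 u^2] decreases on [[r1, z)] from the negative
   value [2 r1^2 F(u(r1))], although it is nonnegative at [z]. *)
Lemma arch_slope_lower n q u v c z b rho r :
  positive_arch n q u v c z ->
  c < b < z -> u b = alpha_star q -> c < rho < z -> u rho = 1 ->
  b <= r < z -> (INR n - 2) * u r + r * Derive u r <= 0.
Proof.
  intros H hb hub hrho hurho.
  pose proof (arch_interval _ _ _ _ _ _ H) as hcz.
  pose proof (arch_exponent _ _ _ _ _ _ H) as hq.
  pose proof (alpha_star_gt_1 q hq) as hal.
  assert (hm : 0 <= INR n - 2).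
  { pose proof (le_INR _ _ (arch_dim _ _ _ _ _ _ H)) as h. simpl in h. lra. }
  assert (hbr : b < rho).
  { apply Rnot_le_lt. intros h. destruct (Req_dec rho b) as [e|e].
    - rewrite e in hurho. lra.
    - pose proof (arch_u_lt _ _ _ _ _ _ rho b H ltac:(lra) ltac:(lra) ltac:(lra)). lra. }
  set (y := fun t => (INR n - 2) * u t + t * Derive u t).
  assert (dy : forall t, c <= t <= z -> is_derive y t (- t * f q (u t))).
  { intros t ht. exact (is_derive_scaling _ _ _ _ _ _ t H ht). }
  (* After [rho] one has [f(u) <= 0], so [y] is nondecreasing up to [y(z) = z u'(z) <= 0]. *)
  assert (hlate : forall t, rho <= t <= z -> y t <= 0).
  { intros t ht. apply Rle_trans with (y z).
    - apply (le_of_deriv_nonneg y (fun t => - t * f q (u t))); [lra| |].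
      + intros s hs. apply dy. lra.
      + intros s hs.
        pose proof (arch_pos _ _ _ _ _ _ H s ltac:(lra)).
        pose proof (arch_u_lt _ _ _ _ _ _ rho s H ltac:(lra) ltac:(lra) ltac:(lra)).
        pose proof (f_le_0 q (u s) hq ltac:(lra)).
        pose proof (Rmult_le_pos s (- f q (u s)) ltac:(lra) ltac:(lra)). lra.
    - unfold y. rewrite (arch_end _ _ _ _ _ _ H).
      pose proof (arch_end_slope _ _ _ _ _ _ H).
      pose proof (Rmult_le_pos z (- Derive u z) ltac:(lra) ltac:(lra)). lra. }
  assert (hearly : forall t1 t2, c <= t1 -> t1 <= t2 -> t2 <= rho -> y t2 <= y t1).
  { intros t1 t2 h1 h12 h2. apply Ropp_le_cancel.
    apply (le_of_deriv_nonneg (fun t => - y t) (fun t => - (- t * f q (u t)))); [lra| |].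
    - intros s hs. apply (is_derive_opp y). apply dy. lra.
    - intros s hs.
      pose proof (arch_u_lt _ _ _ _ _ _ s rho H ltac:(lra) ltac:(lra) ltac:(lra)).
      pose proof (f_gt_0 q (u s) hq ltac:(lra)).
      pose proof (Rmult_le_pos s (f q (u s)) ltac:(lra) ltac:(lra)). lra. }
  assert (hyb : y b <= 0).
  { apply Rnot_lt_le. intros hyb.
    destruct (first_zero_of_continuous y b rho) as (r1 & hr1 & hy1 & _);
      [lra| |exact hyb|apply hlate; lra|].
    { intros x hx. eapply continuous_of_is_derive. apply dy. lra. }
    assert (hafter : forall t, r1 <= t <= z -> y t <= 0).
    { intros t ht. destruct (Rle_lt_dec t rho).
      - rewrite <- hy1. apply hearly; lra.
      - apply hlate. lra. }
    set (D := fun t => t * t * (Derive u t * Derive u t) + 2 * (t * t) * F q (u t)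
                       - (INR n - 2) * (INR n - 2) * (u t * u t)).
    assert (hD1 : D r1 < 0).
    { pose proof (arch_pos _ _ _ _ _ _ H r1 ltac:(lra)).
      pose proof (arch_u_lt _ _ _ _ _ _ b r1 H ltac:(lra) ltac:(lra) ltac:(lra)).
      pose proof (F_lt_0 q (u r1) hq ltac:(lra)) as hF.
      unfold y in hy1. unfold D.
      replace (r1 * r1 * (Derive u r1 * Derive u r1))
        with ((r1 * Derive u r1) * (r1 * Derive u r1)) by ring.
      replace (r1 * Derive u r1) with (- ((INR n - 2) * u r1)) by lra.
      pose proof (Rmult_lt_0_compat (r1 * r1) (- F q (u r1))
        ltac:(apply Rmult_lt_0_compat; lra) ltac:(lra)). lra. }
    assert (hD : forall s, r1 <= s < z -> D s <= D r1).
    { intros s hs. apply Ropp_le_cancel.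
      (* [D' = 4 t F(u) - 2 (n - 2) u' y], and both terms are nonpositive because
         [u < alpha_star q], [u' < 0] and [y <= 0]. *)
      apply (le_of_deriv_nonneg (fun t => - D t)
        (fun t => - (4 * t * F q (u t) - 2 * (INR n - 2) * (Derive u t * y t)))); [lra| |].
      - intros t ht. apply (is_derive_opp D).
        assert (ht' : c <= t < z) by lra. arch_at H t ht'.
        pose proof (is_derive_Rcomp _ u t _ _ (is_derive_F q (u t) ltac:(lra) hur) du).
        unfold D, y. eapply is_derive_eq; [deriv|]. cbv [zero one]; simpl. field. lra.
      - intros t ht. pose proof (hafter t ltac:(lra)) as hyt.
        pose proof (arch_decr _ _ _ _ _ _ H t ltac:(lra)) as hut.
        pose proof (arch_pos _ _ _ _ _ _ H t ltac:(lra)).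
        pose proof (arch_u_lt _ _ _ _ _ _ b t H ltac:(lra) ltac:(lra) ltac:(lra)).
        pose proof (F_lt_0 q (u t) hq ltac:(lra)) as hF.
        pose proof (Rmult_le_pos t (- F q (u t)) ltac:(lra) ltac:(lra)).
        pose proof (Rmult_le_pos _ _ hm (Rmult_le_pos (- Derive u t) (- y t)
          ltac:(lra) ltac:(lra))). lra. }
    (* [g] is [D] with [F(u)] replaced by [- u], which makes continuity at [z] immediate. Close to
       [z] one has [D >= g > D(r1)], against the monotonicity of [D]. *)
    set (g := fun t => t * t * (Derive u t * Derive u t) - 2 * (t * t) * u t
                       - (INR n - 2) * (INR n - 2) * (u t * u t)).
    assert (hgz : D r1 < g z).
    { apply Rlt_le_trans with 0; [exact hD1|]. unfold g.
      rewrite (arch_end _ _ _ _ _ _ H). pose proof (Rle_0_sqr (z * Derive u z)) as hs.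
      unfold Rsqr in hs. lra. }
    assert (cg : continuous g z).
    { pose proof (Derive_correct _ _ (arch_u1 _ _ _ _ _ _ H z ltac:(lra))).
      pose proof (Derive_correct _ _ (arch_u2 _ _ _ _ _ _ H z ltac:(lra))).
      unfold g. eapply continuous_of_is_derive. deriv. }
    destruct (cg (fun x => D r1 < x) (open_gt (D r1) (g z) hgz)) as [e he].
    pose proof (cond_pos e) as hepos.
    set (s := Rmax rho (z - e / 2)).
    assert (hs : rho <= s < z /\ z - e / 2 <= s).
    { unfold s. pose proof (Rmax_l rho (z - e / 2)). pose proof (Rmax_r rho (z - e / 2)).
      pose proof (Rmax_lub_lt rho (z - e / 2) z ltac:(lra) ltac:(lra)). lra. }
    specialize (he s). specialize (hD s ltac:(lra)).
    assert (hgs : D r1 < g s).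
    { apply he. change (Rabs (s - z) < e). rewrite Rabs_left by lra. lra. }
    pose proof (arch_pos _ _ _ _ _ _ H s ltac:(lra)).
    assert (hus : u s <= 1).
    { destruct (Req_dec rho s) as [<-|]; [lra|].
      pose proof (arch_u_lt _ _ _ _ _ _ rho s H ltac:(lra) ltac:(lra) ltac:(lra)). lra. }
    pose proof (F_ge_opp q (u s) hq ltac:(lra)).
    unfold g in hgs. unfold D in hD at 1.
    pose proof (Rmult_le_pos (s * s) (F q (u s) + u s)
      ltac:(apply Rmult_le_pos; lra) ltac:(lra)). lra. }
  intros hr. change (y r <= 0). destruct (Rle_lt_dec r rho).
  - apply Rle_trans with (y b); [|exact hyb]. apply hearly; lra.
  - apply hlate. lra.
Qed.


(** * The increments of [M], [Q] and [Ba] between [b] and [tau] *)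

Lemma arch_v1_neg n q u v c z rho r :
  positive_arch n q u v c z -> 1 < u c -> Derive v c < 0 ->
  rho < z -> u rho = 1 -> c < r < rho ->
  (forall s, c < s <= r -> 0 < v s) -> Derive v r < 0.
Proof.
  intros H huc hvc hrho hurho hr hv.
  pose proof (arch_exponent _ _ _ _ _ _ H) as hq.
  pose proof (arch_u_lt _ _ _ _ _ _ r rho H ltac:(lra) ltac:(lra) ltac:(lra)).
  (* Here [u > 1], so [f(u)] and [f'(u)] are positive and the comparison gives
     [f(u) v' < f'(u) u' v < 0]. *)
  pose proof (arch_fv_pos _ _ _ _ _ _ r H huc hvc ltac:(lra)
    (fun s hs => hv s ltac:(lra))) as hT.
  pose proof (f_gt_0 q (u r) hq ltac:(lra)) as hf.
  pose proof (f_deriv_pos q (u r) hq ltac:(lra)) as hd. fold (df q (u r)) in hd.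
  pose proof (arch_decr _ _ _ _ _ _ H r ltac:(lra)).
  pose proof (Rmult_lt_0_compat _ _ (Rmult_lt_0_compat _ (- Derive u r) hd ltac:(lra))
    (hv r ltac:(lra))).
  apply Rnot_le_lt. intros hv1.
  pose proof (Rmult_le_pos _ _ (Rlt_le _ _ hf) hv1). lra.
Qed.

Lemma is_derive_Qn n q u v c z r :
  positive_arch n q u v c z -> c <= r < z ->
  is_derive (Qn n q u v) r
    (r ^ (n - 1) * ((2 - INR n) * f q (u r) * v r + INR n * Derive u r * Derive v r)).
Proof.
  intros H hr. arch_at H r hr.
  pose proof (is_derive_Q _ _ _ _ _ _ r H hr).
  unfold Qn. eapply is_derive_eq; [deriv|]. cbv [zero one]; simpl. field. lra.
Qed.

(** For [n = 2] the term with [f(u)] drops out of the derivative of [Qn], leaving [2 r u' v' > 0];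
    moreover [Qn(c) = Q(c)]. *)
Lemma arch_Qn_pos_dim2 q u v c z rho r :
  positive_arch 2 q u v c z -> 1 < u c -> Derive v c < 0 -> 0 < Q 2 q u v c ->
  rho < z -> u rho = 1 -> c < r < rho ->
  (forall s, c < s <= r -> 0 < v s) -> 0 < Qn 2 q u v r.
Proof.
  intros H huc hvc hQ hrho hurho hr hv.
  pose proof (arch_interval _ _ _ _ _ _ H) as hcz.
  apply Rlt_trans with (Qn 2 q u v c).
  { unfold Qn. rewrite (arch_crit _ _ _ _ _ _ H). lra. }
  eapply lt_of_deriv_pos; [lra| |].
  - intros s hs. apply (is_derive_Qn 2 q u v c z s H). lra.
  - intros s hs. cbv beta.
    pose proof (arch_decr _ _ _ _ _ _ H s ltac:(lra)).
    pose proof (arch_v1_neg _ _ _ _ _ _ rho s H huc hvc hrho hurho ltac:(lra)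
      (fun t ht => hv t ltac:(lra))).
    pose proof (Rmult_lt_0_compat (- Derive u s) (- Derive v s) ltac:(lra) ltac:(lra)).
    apply Rmult_lt_0_compat; [apply pow_lt; lra|]. simpl INR. lra.
Qed.

(* Since [F] vanishes at [alpha_star q], this is the assertion of the theorem for
   the part of [Ba] that is proportional to [a]. For [n = 2] the function
   [M - (u f(u) - 2 F(u)) r^(n-1) v / u'] is decreasing because [Qn > 0]; for
   [n >= 3] one replaces [u f(u) - 2 F(u)] by the multiple of [u^3] which agrees
   with it at [alpha_star q]. *)
Lemma arch_M_increment n q u v c z b rho tau :
  positive_arch n q u v c z -> 1 < u c -> 0 < v c -> Derive v c < 0 ->
  0 < Q n q u v c ->
  c < b -> u b = alpha_star q -> rho < z -> u rho = 1 ->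
  first_zero_in v c rho tau -> b < tau ->
  M n u v tau <=
  M n u v b - alpha_star q * f q (alpha_star q) * (b ^ (n - 1) * v b / Derive u b).
Proof.
  intros H huc hvc hv1c hQ hb hub hrho hurho htau hbt.
  pose proof (arch_interval _ _ _ _ _ _ H) as hcz.
  pose proof (arch_exponent _ _ _ _ _ _ H) as hq.
  pose proof (alpha_star_gt_1 q hq) as hal.
  pose proof (alpha_star_power q hq) as hpow.
  pose proof (fun r hr => arch_v_pos _ _ _ _ _ _ rho tau r H hvc hrho htau hr) as hv.
  destruct htau as (htr & hvt & _).
  set (al := alpha_star q) in *.
  assert (hu : forall r, b < r < tau -> 1 < u r < al).
  { intros r hr.
    pose proof (arch_u_lt _ _ _ _ _ _ b r H ltac:(lra) ltac:(lra) ltac:(lra)).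
    pose proof (arch_u_lt _ _ _ _ _ _ r rho H ltac:(lra) ltac:(lra) ltac:(lra)). lra. }
  assert (hend : tau ^ (n - 1) * v tau / Derive u tau = 0).
  { rewrite hvt. unfold Rdiv. ring. }
  destruct (Nat.eq_dec n 2) as [->|hn2].
  (* Because [(u f(u) - 2 F(u))' = (u f'(u) - f(u)) u'], the derivative of [M] cancels and only that
     of the ratio is left. *)
  - assert (hle := le_of_deriv_nonneg
      (fun t => - (M 2 u v t - (u t * f q (u t) - 2 * F q (u t))
                                * (t ^ (2 - 1) * v t / Derive u t)))
      (fun r => (u r * f q (u r) - 2 * F q (u r)) * (Qn 2 q u v r / (r * Derive u r ^ 2)))
      b tau ltac:(lra)).
    cbv beta in hle.
    pose proof (F_alpha_star q hq) as hFal. fold al in hFal.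
    rewrite hend, hub, hFal in hle.
    apply Ropp_le_cancel.
    refine (Rle_trans _ _ _ _ (Rle_trans _ _ _ (hle _ _) _)); [lra| | |lra].
    + intros r hr. assert (hr' : c <= r < z) by lra. arch_at H r hr'.
      pose proof (arch_decr _ _ _ _ _ _ H r ltac:(lra)).
      pose proof (is_derive_M _ _ _ _ _ _ r H hr').
      pose proof (is_derive_ratio _ _ _ _ _ _ r H ltac:(lra)).
      pose proof (is_derive_Rcomp _ u r _ _ (is_derive_F q (u r) ltac:(lra) hur) du).
      apply (is_derive_ext (fun t => (u t * f q (u t) - 2 * F q (u t))
                                * (t ^ (2 - 1) * v t / Derive u t) - M 2 u v t)).
      { intros t. simpl. ring. }
      eapply is_derive_eq; [deriv|]. cbv [zero one]; simpl. field. lra.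
    + intros r hr. pose proof (hu r hr).
      pose proof (arch_decr _ _ _ _ _ _ H r ltac:(lra)).
      rewrite xf_sub_2F by lra.
      apply Rmult_le_pos.
      * assert (1 < 2 / q) by (apply Rlt_div_r; lra).
        pose proof (Rpower_pos (u r) (q - 1)).
        apply Rmult_le_pos; [apply Rmult_le_pos|]; lra.
      * apply Rdiv_le_0_compat.
        -- left. apply (arch_Qn_pos_dim2 q u v c z rho r H); try assumption; [lra|].
           intros s hs. apply hv. lra.
        -- apply Rmult_lt_0_compat; [lra|]. apply pow2_gt_0. lra.
  (* This is the constant of [f_le_square]; with it [lam u^3] and [u f(u) - 2 F(u)] agree at
     [u = al], where [F] vanishes. *)
  - set (lam := (2 - q) / (2 * al)).
    assert (hlam : al * f q al = lam * (al * al * al)).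
    { rewrite f_pos_eq, hpow by lra. unfold lam. field. lra. }
    assert (hN : 3 <= INR n).
    { pose proof (arch_dim _ _ _ _ _ _ H).
      pose proof (le_INR 3 n ltac:(lia)) as h. simpl in h. lra. }
    assert (hle := le_of_deriv_nonneg
      (fun t => lam * (u t * u t * u t) * (t ^ (n - 1) * v t / Derive u t) - M n u v t)
      (fun r => r ^ (n - 1) * v r * (3 * lam * (u r * u r) - (2 - q) * Rpower (u r) (q - 1))
                + lam * (u r * u r * u r) * (Qn n q u v r / (r * Derive u r ^ 2)))
      b tau ltac:(lra)).
    cbv beta in hle. rewrite hend, hub in hle. rewrite hlam.
    apply Ropp_le_cancel.
    refine (Rle_trans _ _ _ _ (Rle_trans _ _ _ (hle _ _) _)); [lra| | |lra].
    + intros r hr. assert (hr' : c <= r < z) by lra. arch_at H r hr'.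
      pose proof (arch_decr _ _ _ _ _ _ H r ltac:(lra)).
      pose proof (is_derive_M _ _ _ _ _ _ r H hr').
      pose proof (is_derive_ratio _ _ _ _ _ _ r H ltac:(lra)).
      rewrite <- x_df_sub_f by exact hur.
      eapply is_derive_eq; [deriv|]. cbv [zero one]; simpl. field. lra.
    + intros r hr. pose proof (hu r hr) as hur.
      assert (hr' : c <= r < z) by lra.
      pose proof (arch_decr _ _ _ _ _ _ H r ltac:(lra)) as hu1.
      pose proof (hv r ltac:(lra)) as hvr.
      assert (hp : 0 < r ^ (n - 1)) by (apply pow_lt; lra).
      pose proof (arch_fv_pos _ _ _ _ _ _ r H huc hv1c ltac:(lra)
        (fun s hs => hv s ltac:(lra))) as hT.
      pose proof (f_gt_0 q (u r) hq ltac:(lra)) as hf.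
      pose proof (f_le_square q (u r) hq ltac:(unfold al in hur; lra)) as hsq.
      fold al lam in hsq.
      pose proof (arch_slope_lower _ _ _ _ _ _ b rho r H ltac:(lra) hub ltac:(lra) hurho
        ltac:(lra)) as hy.
      pose proof (x_df_sub_f q (u r) ltac:(lra)) as hxdf.
      pose proof (Rpower_pos (u r) (q - 1)) as hw.
      (* The Sturm comparison divided by [f(u) u' < 0]. *)
      assert (h1 : df q (u r) * v r / f q (u r) <= Derive v r / Derive u r).
      { apply Rminus_le_0.
        replace (Derive v r / Derive u r - df q (u r) * v r / f q (u r))
          with ((df q (u r) * Derive u r * v r - f q (u r) * Derive v r)
                / (f q (u r) * - Derive u r)) by (field; lra).
        apply Rdiv_le_0_compat; [lra|]. apply Rmult_lt_0_compat; lra. }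
      (* By the slope bound it suffices that [2 n - 2 <= 4 (n - 2)], which is the condition
         [n >= 3]. *)
      assert (h2 : - (4 / u r) <= (2 * INR n - 2) / (r * Derive u r)).
      { apply Rminus_le_0.
        replace ((2 * INR n - 2) / (r * Derive u r) - - (4 / u r))
          with ((- (2 * INR n - 2) * u r - 4 * (r * Derive u r)) / (r * - Derive u r * u r))
          by (field; lra).
        apply Rdiv_le_0_compat.
        - pose proof (Rmult_le_pos (2 * (INR n - 3)) (u r) ltac:(lra) ltac:(lra)). lra.
        - apply Rmult_lt_0_compat; [apply Rmult_lt_0_compat|]; lra. }
      assert (hQn : Qn n q u v r / (r * Derive u r ^ 2)
        = r ^ (n - 1) * (Derive v r / Derive u r + f q (u r) * v r / Derive u r ^ 2
            + (2 * INR n - 2) / (r * Derive u r) * v r)).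
      { unfold Qn, Q. rewrite (pow_pred n r) by exact (arch_dim _ _ _ _ _ _ H).
        field. lra. }
      rewrite hQn.
      assert (h3 : 0 <= f q (u r) * v r / Derive u r ^ 2).
      { apply Rdiv_le_0_compat; [apply Rmult_le_pos; lra|]. apply pow2_gt_0. lra. }
      assert (hlam0 : 0 < lam) by (apply Rdiv_lt_0_compat; lra).
      set (w := Rpower (u r) (q - 1)) in *.
      assert (hcube : 0 <= lam * (u r * u r * u r)).
      { apply Rmult_le_pos; [lra|]. repeat apply Rmult_le_pos; lra. }
      (* Inserting [u f'(u) = f(u) + (2 - q) w] factors this expression, and its sign is that of
         [lam u^2 - f(u)], which [f_le_square] controls. *)
      assert (h4 : 0 <= v r * (3 * lam * (u r * u r) - (2 - q) * w)
         + lam * (u r * u r * u r) * (df q (u r) * v r / f q (u r) - 4 / u r * v r)).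
      { replace (v r * (3 * lam * (u r * u r) - (2 - q) * w)
           + lam * (u r * u r * u r) * (df q (u r) * v r / f q (u r) - 4 / u r * v r))
          with (v r * ((2 - q) * w) * ((lam * u r ^ 2 - f q (u r)) / f q (u r))).
        - apply Rmult_le_pos.
          + apply Rmult_le_pos; [lra|]. apply Rmult_le_pos; lra.
          + apply Rdiv_le_0_compat; lra.
        - rewrite <- hxdf. field. lra. }
      assert (h5 : df q (u r) * v r / f q (u r) - 4 / u r * v r
         <= Derive v r / Derive u r + f q (u r) * v r / Derive u r ^ 2
            + (2 * INR n - 2) / (r * Derive u r) * v r).
      { pose proof (Rmult_le_compat_r (v r) _ _ ltac:(lra) h2). lra. }
      pose proof (Rmult_le_compat_l _ _ _ hcube h5) as h6.
      match goal with |- 0 <= ?X => replace X with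
        (r ^ (n - 1) * (v r * (3 * lam * (u r * u r) - (2 - q) * w)
          + lam * (u r * u r * u r) * (Derive v r / Derive u r
            + f q (u r) * v r / Derive u r ^ 2
            + (2 * INR n - 2) / (r * Derive u r) * v r))) by ring end.
      apply Rmult_le_pos; lra.
Qed.

Lemma is_RInt_Ba n q a u v c z b tau :
  positive_arch n q u v c z -> c < b -> b < tau -> tau < z ->
  is_RInt (fun r => - 2 * Fa q a (u r) * (Qn n q u v r / (r * Derive u r ^ 2))) b tau
    (Ba n q a u v tau - Ba n q a u v b).
Proof.
  intros H hb hbt ht.
  pose proof (arch_interval _ _ _ _ _ _ H) as hcz.
  apply (is_RInt_derive (Ba n q a u v)).
  - intros r. rewrite Rmin_left, Rmax_right by lra. intros hr.
    apply (is_derive_Ba n q a u v c z r H). lra.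
  - intros r. rewrite Rmin_left, Rmax_right by lra. intros hr.
    assert (hr' : c <= r < z) by lra. arch_at H r hr'.
    pose proof (arch_decr _ _ _ _ _ _ H r ltac:(lra)).
    pose proof (is_derive_Rcomp _ u r _ _ (is_derive_Fa q a (u r) ltac:(lra) hur) du).
    pose proof (is_derive_Qn _ _ _ _ _ _ r H hr').
    (* The square of [u'] has to be posed as a whole, since [deriv] has no rule for powers. *)
    pose proof (is_derive_pow _ 2 r _ du1).
    eapply continuous_of_is_derive. deriv.
    apply Rmult_integral_contrapositive_currified; [lra|]. apply pow_nonzero. lra.
Qed.

Lemma arch_Ba_increment n q a u v c z b rho tau :
  positive_arch n q u v c z -> 1 < u c -> 0 < v c -> Derive v c < 0 ->
  0 < Q n q u v c ->
  c < b -> u b = alpha_star q -> rho < z -> u rho = 1 ->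
  first_zero_in v c rho tau -> b < tau -> 0 <= a ->
  0 < Ba n q a u v tau - Ba n q a u v b.
Proof.
  intros H huc hvc hv1c hQ hb hub hrho hurho htau hbt ha.
  pose proof (arch_interval _ _ _ _ _ _ H) as hcz.
  pose proof (arch_exponent _ _ _ _ _ _ H) as hq.
  pose proof (arch_M_increment _ _ _ _ _ _ b rho tau H huc hvc hv1c hQ hb hub hrho hurho
    htau hbt) as hM.
  pose proof (fun r hr => arch_v_pos _ _ _ _ _ _ rho tau r H hvc hrho htau hr) as hv.
  destruct htau as (htr & hvt & _).
  assert (hQi : Q n q u v b < Q n q u v tau).
  { eapply lt_of_deriv_pos; [exact hbt| |].
    - intros r hr. apply (is_derive_Q n q u v c z r H). lra.
    - intros r hr. cbv beta.
      pose proof (arch_u_lt _ _ _ _ _ _ r rho H ltac:(lra) ltac:(lra) ltac:(lra)).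
      pose proof (f_gt_0 q (u r) hq ltac:(lra)).
      pose proof (hv r ltac:(lra)).
      assert (0 < r ^ (n - 1)) by (apply pow_lt; lra).
      apply Rmult_lt_0_compat; [apply Rmult_lt_0_compat|]; lra. }
  (* After these values are inserted, the difference is the increment of [Q] minus [a] times the
     quantity that [hM] bounds above by 0. *)
  unfold Ba, Fa. rewrite hvt, hub, F_alpha_star by exact hq.
  replace (tau ^ (n - 1) * 0 / Derive u tau) with 0 by (unfold Rdiv; ring).
  pose proof (Rmult_le_pos _ _ ha (Rge_le _ _ (Rge_minus _ _ (Rle_ge _ _ hM)))).
  lra.
Qed.

Lemma arch_conclusion n q u v c z b rho :
  positive_arch n q u v c z ->
  c < b < z -> u b = alpha_star q -> c < rho < z -> u rho = 1 ->
  0 < Q n q u v c -> 0 < M n u v c ->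
  (exists tau, first_zero_in v c rho tau) /\
  (forall tau, first_zero_in v c rho tau -> b < tau ->
   forall a, 0 <= a ->
   let integrand := fun r =>
     - 2 * Fa q a (u r) * (Qn n q u v r / (r * Derive u r ^ 2)) in
   is_RInt integrand b tau (Ba n q a u v tau - Ba n q a u v b) /\
   0 < Ba n q a u v tau - Ba n q a u v b).
Proof.
  intros H hb hub hrho hurho hQ hM.
  pose proof (arch_interval _ _ _ _ _ _ H) as hcz.
  pose proof (alpha_star_gt_1 q (arch_exponent _ _ _ _ _ _ H)).
  pose proof (arch_u_lt _ _ _ _ _ _ c b H ltac:(lra) ltac:(lra) ltac:(lra)).
  assert (huc : 1 < u c) by lra.
  destruct (arch_initial_signs _ _ _ _ _ _ H huc hQ hM) as [hvc hv1c].
  split.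
  - now apply (arch_first_zero n q u v c z rho H).
  - intros tau htau hbt a ha. split.
    + apply (is_RInt_Ba n q a u v c z b tau H); try lra.
      destruct htau as (h & _). lra.
    + apply (arch_Ba_increment n q a u v c z b rho tau H); try assumption; lra.
Qed.


(** * Reduction to positive arches by oddness *)

Lemma f_sign (q s x : R) : s = 1 \/ s = -1 -> f q (s * x) = s * f q x.
Proof.
  intros [-> | ->].
  - now rewrite !Rmult_1_l.
  - replace (-1 * x) with (- x) by ring. rewrite f_opp. ring.
Qed.

Lemma F_sign (q s x : R) : s = 1 \/ s = -1 -> F q (s * x) = F q x.
Proof.
  intros [-> | ->].
  - now rewrite Rmult_1_l.
  - replace (-1 * x) with (- x) by ring. apply F_opp.
Qed.

Lemma Derive_f_sign (q s x : R) :
  s = 1 \/ s = -1 -> 0 < s * x -> Derive (f q) (s * x) = Derive (f q) x.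
Proof.
  intros [-> | ->] hx.
  - now rewrite Rmult_1_l.
  - rewrite <- (Derive_f_opp q (-1 * x) hx). f_equal. ring.
Qed.

(** Multiplying both [u] and [v] by [s] preserves the two equations, as [f] is odd and [f'] is
    even. *)
Lemma positive_arch_of_sign n q u v c z s :
  s = 1 \/ s = -1 -> (2 <= n)%nat -> 1 < q < 2 -> 0 < c < z ->
  (forall r, c <= r < z -> 0 < s * u r) -> u z = 0 -> Derive u c = 0 ->
  (forall r, c < r < z -> Derive u r <> 0) ->
  (forall r, c <= r <= z -> ex_derive u r) ->
  (forall r, c <= r <= z -> ex_derive (Derive u) r /\
    Derive (Derive u) r + (INR n - 1) / r * Derive u r + f q (u r) = 0) ->
  (forall r, c <= r < z -> ex_derive v r) ->
  (forall r, c <= r < z -> ex_derive (Derive v) r /\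
    Derive (Derive v) r + (INR n - 1) / r * Derive v r + Derive (f q) (u r) * v r = 0) ->
  positive_arch n q (fun r => s * u r) (fun r => s * v r) c z.
Proof.
  intros hs hn hq hcz hpos hz hc hne hu1 hu2 hv1 hv2.
  assert (hD : forall w r, Derive (fun t => s * w t) r = s * Derive w r).
  { intros w r. apply Derive_scal. }
  assert (hDD : forall w r, Derive (Derive (fun t => s * w t)) r = s * Derive (Derive w) r).
  { intros w r. rewrite <- hD. apply Derive_ext. intros t. apply hD. }
  assert (hex : forall w r, ex_derive w r -> ex_derive (fun t => s * w t) r).
  { intros w r. apply (ex_derive_scal w s r). }
  constructor; try assumption.
  - rewrite hz. ring.
  - rewrite hD, hc. ring.
  - assert (hcont : forall r, c <= r <= z -> continuous (Derive (fun t => s * u t)) r).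
    { intros r hr. apply (continuous_ext (fun t => s * Derive u t)).
      - intros t. symmetry. apply hD.
      - apply (ex_derive_continuous (fun t => s * Derive u t)).
        apply hex. now apply hu2. }
    (* [s u] falls from a positive value to 0, so its derivative is negative somewhere, hence
       everywhere in [(c, z)] since it has no zero there. *)
    destruct (MVT_cor2 (fun t => s * u t) (Derive (fun t => s * u t)) c z) as (x & hx & hxr).
    + lra.
    + intros r hr. apply is_derive_Reals, Derive_correct, hex, hu1. exact hr.
    + intros r hr. apply (neg_of_no_zero _ c z x r).
      * intros t ht. apply hcont. lra.
      * intros t ht. rewrite hD. apply Rmult_integral_contrapositive_currified.
        -- destruct hs as [-> | ->]; lra.
        -- now apply hne.
      * exact hxr.
      * exact hr.
      * cbv beta in hx. rewrite hz in hx. pose proof (hpos c ltac:(lra)).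
        apply Rnot_le_lt. intros h.
        pose proof (Rmult_le_pos _ (z - c) h ltac:(lra)). lra.
  - intros r hr. now apply hex, hu1.
  - intros r hr. apply (ex_derive_ext (fun t => s * Derive u t)).
    + intros t. symmetry. apply hD.
    + now apply hex, hu2.
  - intros r hr. rewrite hDD, hD, f_sign by exact hs.
    destruct (hu2 r hr) as [_ h]. rewrite <- (Rmult_0_r s), <- h. ring.
  - intros r hr. now apply hex, hv1.
  - intros r hr. apply (ex_derive_ext (fun t => s * Derive v t)).
    + intros t. symmetry. apply hD.
    + now apply hex, hv2.
  - intros r hr. rewrite hDD, hD, Derive_f_sign by auto.
    destruct (hv2 r hr) as [_ h]. rewrite <- (Rmult_0_r s), <- h. ring.
Qed.

Lemma Q_sign n q u v s r :
  s = 1 \/ s = -1 -> Q n q (fun t => s * u t) (fun t => s * v t) r = Q n q u v r.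
Proof.
  intros hs. unfold Q. rewrite !Derive_scal, f_sign by exact hs.
  destruct hs as [-> | ->]; ring.
Qed.

Lemma M_sign n u v s r :
  s = 1 \/ s = -1 -> M n (fun t => s * u t) (fun t => s * v t) r = M n u v r.
Proof.
  intros hs. unfold M. rewrite !Derive_scal. destruct hs as [-> | ->]; ring.
Qed.

Lemma Qn_sign n q u v s r :
  s = 1 \/ s = -1 -> Qn n q (fun t => s * u t) (fun t => s * v t) r = Qn n q u v r.
Proof.
  intros hs. unfold Qn. rewrite Q_sign, !Derive_scal by exact hs.
  destruct hs as [-> | ->]; ring.
Qed.

Lemma Fa_sign q a s x : s = 1 \/ s = -1 -> Fa q a (s * x) = Fa q a x.
Proof.
  intros hs. unfold Fa. rewrite F_sign, f_sign by exact hs.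
  destruct hs as [-> | ->]; ring.
Qed.

(** For [y = 0] both sides are 0 by the convention [/ 0 = 0], so [Ba_sign] holds also at critical
    points of [u]. *)
Lemma sign_mul_div s x y : s = 1 \/ s = -1 -> s * x / (s * y) = x / y.
Proof.
  intros hs. destruct (Req_dec y 0) as [->|hy].
  - rewrite Rmult_0_r. unfold Rdiv. rewrite Rinv_0. ring.
  - field. split; [exact hy|]. destruct hs as [-> | ->]; lra.
Qed.

Lemma Ba_sign n q a u v s r :
  s = 1 \/ s = -1 ->
  Ba n q a (fun t => s * u t) (fun t => s * v t) r = Ba n q a u v r.
Proof.
  intros hs. unfold Ba. rewrite Q_sign, M_sign, Fa_sign, Derive_scal by exact hs.
  replace (r ^ (n - 1) * (s * v r)) with (s * (r ^ (n - 1) * v r)) by ring.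
  now rewrite sign_mul_div.
Qed.

Lemma first_zero_in_sign v a b tau s :
  s = 1 \/ s = -1 ->
  first_zero_in (fun r => s * v r) a b tau <-> first_zero_in v a b tau.
Proof.
  intros hs. assert (hs0 : s <> 0) by (destruct hs as [-> | ->]; lra).
  split; intros (h1 & h2 & h3); (split; [exact h1|]); split.
  - now destruct (Rmult_integral _ _ h2).
  - intros r hr h. apply (h3 r hr). rewrite h. ring.
  - rewrite h2. ring.
  - intros r hr. apply Rmult_integral_contrapositive_currified; auto.
Qed.

(** * Location of the zeros and application to the arch from [c (i - 1)] to [z i] *)

Lemma zeros_facts u zu k z :
  first_double_zero u zu ->
  (bound_state u /\ zeros_before u zu k z /\ Finite (z (S k)) = zu)
  \/ (~ bound_state u /\ zeros_before u zu (S k) z /\ zu = p_infty) ->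
  (forall j, (1 <= j <= k)%nat -> 0 < z j < z (S j)) /\
  (forall j, (1 <= j <= S k)%nat -> u (z j) = 0) /\
  (forall r, r < z (S k) -> Rbar_lt r zu) /\
  (forall r, 0 < r < z (S k) -> u r = 0 -> exists j, (1 <= j <= k)%nat /\ r = z j).
Proof.
  (* For a bound state [z (S k)] is the double zero [zu]; otherwise it is the last of the simple
     zeros and [zu] is infinite. *)
  intros hzu [(_ & (hord & hin & hzero) & <-)|(_ & (hord & hin & hzero) & ->)].
  - split; [|split; [|split]].
    + intros j hj. split; [now apply hin|].
      destruct (Nat.eq_dec j k) as [->|hne]; [now apply (hin k)|].
      apply hord. lia.
    + intros j hj. destruct (Nat.eq_dec j (S k)) as [->|hne]; [apply hzu|].
      destruct (hin j ltac:(lia)) as [h1 h2].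
      apply (hzero (z j) h1 h2). exists j. split; [lia|reflexivity].
    + intros r hr. exact hr.
    + intros r hr hur. now apply (hzero r (proj1 hr) (proj2 hr)).
  - split; [|split; [|split]].
    + intros j hj. split; [apply hin; lia|]. apply hord. lia.
    + intros j hj. destruct (hin j hj) as [h1 h2].
      apply (hzero (z j) h1 h2). exists j. split; [lia|reflexivity].
    + intros r hr. exact I.
    + intros r hr hur. destruct (proj1 (hzero r (proj1 hr) I) hur) as (j & hj & ->).
      exists j. split; [|reflexivity].
      destruct (Nat.eq_dec j (S k)) as [->|hne]; [lra|lia].
Qed.

Lemma increasing_index (z : nat -> R) (k : nat) :
  (forall j, (1 <= j <= k)%nat -> z j < z (S j)) ->
  forall j l, (1 <= j)%nat -> (j <= l)%nat -> (l <= S k)%nat -> z j <= z l.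
Proof.
  intros h j l hj hjl. induction hjl as [|l hjl IH]; intros hl; [lra|].
  pose proof (IH ltac:(lia)). pose proof (h l ltac:(lia)). lra.
Qed.

Theorem lemma4p3 (n : nat) (hn : (2 <= n)%nat) (q : R) (hq : 1 < q < 2)
  (U : R -> R -> R)
  (hU : forall beta, 0 < beta -> radial_solution n q beta (U beta))
  (alpha : R) (halpha : 0 < alpha)
  (zu : Rbar) (hzu : first_double_zero (U alpha) zu)
  (hv : regular_variation n q U alpha zu)
  (hnodal : nodal (U alpha) zu)
  (k : nat) (hk : (1 <= k)%nat)
  (z c b rho : nat -> R)
  (hz : (bound_state (U alpha) /\ zeros_before (U alpha) zu k z
           /\ Finite (z (S k)) = zu)
        \/ (~ bound_state (U alpha) /\ zeros_before (U alpha) zu (S k) z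
           /\ zu = p_infty))
  (hc : critical_points (U alpha) k z c)
  (hb : level_points (U alpha) k z c (alpha_star q) b)
  (hrho : level_points (U alpha) k z c 1 rho)
  (i : nat) (hi : (2 <= i <= S k)%nat)
  (hQ : 0 < Q n q (U alpha) (d_alpha U alpha) (c (i - 1)%nat))
  (hM : 0 < M n (U alpha) (d_alpha U alpha) (c (i - 1)%nat)) :
  let u := U alpha in
  let v := d_alpha U alpha in
  (exists tau, first_zero_in v (c (i - 1)%nat) (rho i) tau) /\
  (forall tau, first_zero_in v (c (i - 1)%nat) (rho i) tau -> b i < tau ->
   forall ut, Rabs (u (b i)) <= ut ->
   let a := g2 q ut in
   let integrand := fun r =>
     - 2 * Fa q a (u r) * (Qn n q u v r / (r * Derive u r ^ 2)) in
   0 <= a /\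
   ex_RInt integrand (b i) tau /\
   Ba n q a u v tau - Ba n q a u v (b i) = RInt integrand (b i) tau /\
   0 < RInt integrand (b i) tau).
Proof.
  intros u v.
  destruct (hU alpha halpha) as ((_ & _ & _ & hu1) & hu2). fold u in hu1, hu2.
  destruct hv as (_ & (_ & _ & _ & hv1) & hv2). fold u v in hv1, hv2.
  destruct (zeros_facts u zu k z hzu hz) as (hzord & hz0 & hzlt & hzero).
  destruct hc as (_ & hcin & hcrit). fold u in hcrit.
  pose proof (increasing_index z k (fun j hj => proj2 (hzord j hj))) as hmono.
  (* As [i >= 2], the index [j] is at least 1 and [c j] lies between the consecutive zeros [z j] and
     [z i]. *)
  set (j := (i - 1)%nat) in *.
  assert (hij : i = S j) by lia.
  destruct (hb i ltac:(lia)) as [hbi hubi]. fold u j in hbi, hubi.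
  destruct (hrho i ltac:(lia)) as [hri huri]. fold u j in hri, huri.
  pose proof (hcin j ltac:(lia)) as hcj. rewrite <- hij in hcj.
  pose proof (hzord j ltac:(lia)) as hzj.
  pose proof (hmono i (S k) ltac:(lia) ltac:(lia) ltac:(lia)) as hik.
  assert (hne : forall r, z j < r < z i -> u r <> 0).
  { intros r hr hur. destruct (hzero r ltac:(lra) hur) as (l & hl & ->).
    destruct (Nat.le_gt_cases l j) as [h|h].
    - pose proof (hmono l j ltac:(lia) h ltac:(lia)). lra.
    - pose proof (hmono i l ltac:(lia) ltac:(lia) ltac:(lia)). lra. }
  assert (hdne : forall r, c j < r < z i -> Derive u r <> 0).
  { intros r hr hur. destruct (proj1 (hcrit r ltac:(lra)) hur) as (l & hl & ->).
    destruct (Nat.le_gt_cases l j) as [h|h].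
    - destruct (Nat.eq_dec l j) as [->|hlj]; [lra|].
      pose proof (hcin l hl). pose proof (hmono (S l) j ltac:(lia) ltac:(lia) ltac:(lia)).
      lra.
    - pose proof (hcin l hl). pose proof (hmono i l ltac:(lia) ltac:(lia) ltac:(lia)). lra. }
  (* [s] is the sign of [u] on the whole interval between these two zeros. *)
  assert (hs : exists s, (s = 1 \/ s = -1) /\ 0 < s * u (c j)).
  { destruct (Rtotal_order (u (c j)) 0) as [h|[h|h]].
    - exists (-1). split; [auto|lra].
    - exfalso. apply (hne (c j)); [lra|exact h].
    - exists 1. split; [auto|lra]. }
  destruct hs as (s & hs & hsc).
  assert (hs0 : s <> 0) by (destruct hs as [-> | ->]; lra).
  assert (hpos : forall r, c j <= r < z i -> 0 < s * u r).
  { intros r hr. apply Ropp_lt_cancel. rewrite Ropp_0.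
    apply (neg_of_no_zero (fun t => - (s * u t)) (z j) (z i) (c j) r); try lra.
    - intros t ht. apply (continuous_opp (fun t => s * u t)).
      apply (continuous_scal_r s u).
      apply (ex_derive_continuous u), hu1; [lra|exact I].
    - intros t ht. apply Ropp_neq_0_compat.
      apply Rmult_integral_contrapositive_currified; [exact hs0|]. now apply hne. }
  assert (H : positive_arch n q (fun r => s * u r) (fun r => s * v r) (c j) (z i)).
  { apply positive_arch_of_sign; try assumption.
    - lra.
    - apply hz0. lia.
    - apply hcrit; [lra|]. exists j. split; [lia|reflexivity].
    - intros r hr. apply hu1; [lra|exact I].
    - intros r hr. apply hu2. lra.
    - intros r hr. apply hv1; [lra|]. apply hzlt. lra.
    - intros r hr. apply hv2; [lra| |apply hne; lra]. apply hzlt. lra. }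
  assert (habs : forall r, c j <= r < z i -> s * u r = Rabs (u r)).
  { intros r hr. rewrite <- (Rabs_pos_eq (s * u r)) by (left; now apply hpos).
    rewrite Rabs_mult. replace (Rabs s) with 1; [ring|].
    destruct hs as [-> | ->]; [now rewrite Rabs_R1|].
    rewrite Rabs_left; lra. }
  destruct (arch_conclusion n q _ _ (c j) (z i) (b i) (rho i) H) as [htau hmain].
  - exact hbi.
  - rewrite habs by lra. exact hubi.
  - exact hri.
  - rewrite habs by lra. exact huri.
  - now rewrite Q_sign.
  - now rewrite M_sign.
  - split.
    + destruct htau as (tau & htau). exists tau.
      now apply (first_zero_in_sign v (c j) (rho i) tau s hs).
    + intros tau htau' hbt ut hut a integrand.
      assert (ha : 0 <= a).
      (* The level condition at [b i] turns the assumption on [ut] into [alpha_star q <= ut]. *)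
      { apply g2_ge_0; [exact hq|]. rewrite <- hubi. exact hut. }
      destruct (hmain tau (proj2 (first_zero_in_sign v _ _ tau s hs) htau') hbt a ha)
        as [hint hgt].
      rewrite !Ba_sign in hint, hgt by exact hs.
      assert (hI : is_RInt integrand (b i) tau (Ba n q a u v tau - Ba n q a u v (b i))).
      { refine (is_RInt_ext _ _ _ _ _ _ hint). intros r _.
        unfold integrand. rewrite Fa_sign, Qn_sign, Derive_scal by exact hs.
        replace ((s * Derive u r) ^ 2) with (Derive u r ^ 2)
          by (destruct hs as [-> | ->]; ring).
        reflexivity. }
      pose proof (is_RInt_unique _ _ _ _ hI) as hR.
      split; [exact ha|]. split; [now eexists; exact hI|].
      split; [now symmetry|]. rewrite hR. exact hgt.
Qed.
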